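(* Let $\mathfrak{H}$ be a separable Hilbert space with an orthogonal decomposition $\mathfrak{H}=\mathfrak{H}_0\oplus\mathfrak{H}_1$, let $A_0$, $A_1$ be bounded self-adjoint operators on $\mathfrak{H}_0$, $\mathfrak{H}_1$ respectively, let $V:\mathfrak{H}_1\to\mathfrak{H}_0$ be a bounded operator, and let $\lambda\in\mathbb{R}$ satisfy $\sup\mathrm{spec}(A_0)\le\lambda\le\inf\mathrm{spec}(A_1)$. Then a contractive solution $X:\mathfrak{H}_0\to\mathfrak{H}_1$ to the Riccati equation $$A_1X-XA_0-XVX+V^*=0$$ satisfying the two properties (i) $\mathrm{Ker}(A_0-\lambda)\cap\mathrm{Ker}\,V^*\subset\mathrm{Ker}\,X$, (ii) $\mathrm{spec}(A_0+VX)\subset(-\infty,\lambda]$ is unique.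
   Context: $\mathrm{spec}(T)$ denotes the spectrum of $T$. A contractive solution is a bounded operator $X:\mathfrak{H}_0\to\mathfrak{H}_1$ with $\|X\|\le1$ satisfying the Riccati equation. *)

(* Defs.v *)
From HB Require Import structures.
From mathcomp Require Import all_boot all_order all_algebra sesquilinear.
From mathcomp Require Import complex.
From mathcomp Require Import all_classical all_reals all_analysis.
Set Implicit Arguments.
Unset Strict Implicit.
Unset Printing Implicit Defensive.
Import Order.TTheory GRing.Theory Num.Theory.
Import numFieldNormedType.Exports.
Local Open Scope classical_set_scope.
Local Open Scope complex_scope.
Local Open Scope ring_scope.

(* Complex Hilbert spaces.  A [{dot H for Num.conj}] is linear in its first
   and conjugate-linear in its second argument. *)
HB.mixin Record CompleteNormedModule_isHilbert (R : realType) H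
    of CompleteNormedModule R[i] H := {
  inner : {dot H for (@Num.conj R[i])};
  inner_normE : forall x : H, inner x x = `|x| ^+ 2
}.

#[short(type="hilbertType")]
HB.structure Definition Hilbert (R : realType) :=
  {H of CompleteNormedModule R[i] H & CompleteNormedModule_isHilbert R H}.

Definition separable (T : topologicalType) : Prop :=
  exists2 D : set T, countable D & dense D.

Definition ker (T : Type) (U : zmodType) (f : T -> U) : set T :=
  f @^-1` [set 0].

(* H is the orthogonal sum of two closed subspaces, given as the ranges of the
   isometric embeddings J0 and J1 of Hilbert spaces H0 and H1; when H0 and H1
   are actual subspaces of H, J0 and J1 are the inclusions. *)
Definition orthogonal_decomposition (R : realType) (H H0 H1 : hilbertType R)
    (J0 : {linear H0 -> H}) (J1 : {linear H1 -> H}) : Prop :=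
  [/\ forall x y : H0, inner (J0 x) (J0 y) = inner x y,
      forall x y : H1, inner (J1 x) (J1 y) = inner x y,
      forall (x : H0) (y : H1), inner (J0 x) (J1 y) = 0 &
      forall z : H, exists (x : H0) (y : H1), z = J0 x + J1 y].

Section Operators.
Variables (R : realType) (H K : hilbertType R).

Definition bounded_operator (T : {linear H -> K}) : Prop :=
  exists M : R, forall x : H, `|T x| <= M%:C * `|x|.

(* Norms take values in R[i], on the real axis; hence the real part.  The set
   below is bounded exactly when T is a bounded operator. *)
Definition opnorm (T : {linear H -> K}) : R :=
  sup [set complex.Re `|T x| | x in [set x : H | `|x| <= 1]].

(* For a bounded T, the vector z such that <T x, y> = <x, z> for all x exists
   by the Riesz representation theorem, and it is unique. *)
Definition adjoint (T : {linear H -> K}) (y : K) : H :=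
  xget 0 [set z : H | forall x : H, inner (T x) y = inner x z].

End Operators.

Definition self_adjoint (R : realType) (H : hilbertType R)
    (T : {linear H -> H}) : Prop :=
  forall x y : H, inner (T x) y = inner x (T y).

Definition resolvent_set (R : realType) (H : hilbertType R)
    (T : {linear H -> H}) : set R[i] :=
  [set z | exists S : {linear H -> H},
     [/\ bounded_operator S,
         forall x, S (T x - z *: x) = x &
         forall x, T (S x) - z *: S x = x]].

Definition spectrum (R : realType) (H : hilbertType R)
    (T : {linear H -> H}) : set R[i] := ~` resolvent_set T.

(* Only meant for operators with real spectrum.  On the zero space, where the
   spectrum is empty, these are -oo and +oo. *)
Definition sup_spectrum (R : realType) (H : hilbertType R)
    (T : {linear H -> H}) : \bar R :=
  ereal_sup [set (complex.Re z)%:E | z in spectrum T].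

Definition inf_spectrum (R : realType) (H : hilbertType R)
    (T : {linear H -> H}) : \bar R :=
  ereal_inf [set (complex.Re z)%:E | z in spectrum T].

Definition riccati (R : realType) (H0 H1 : hilbertType R)
    (A0 : {linear H0 -> H0}) (A1 : {linear H1 -> H1}) (V : {linear H1 -> H0})
    (X : {linear H0 -> H1}) : Prop :=
  forall x : H0, A1 (X x) - X (A0 x) - X (V (X x)) + adjoint V x = 0.

Definition contractive_solution (R : realType) (H0 H1 : hilbertType R)
    (A0 : {linear H0 -> H0}) (A1 : {linear H1 -> H1}) (V : {linear H1 -> H0})
    (X : {linear H0 -> H1}) : Prop :=
  [/\ bounded_operator X, opnorm X <= 1 & riccati A0 A1 V X].

(* Main.v *)
Require Import Defs.
From HB Require Import structures.
From mathcomp Require Import all_boot all_order all_algebra sesquilinear.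
From mathcomp Require Import complex.
From mathcomp Require Import all_classical all_reals all_analysis.
From mathcomp Require Import ring lra.
Set Implicit Arguments.
Unset Strict Implicit.
Unset Printing Implicit Defensive.
Import Order.TTheory GRing.Theory Num.Theory.
Import numFieldNormedType.Exports.
Local Open Scope classical_set_scope.
Local Open Scope complex_scope.
Local Open Scope ring_scope.

(** The solutions are the operators whose graphs reduce the self-adjoint block
operator B with rows (A0, V) and (V^*, A1) on the orthogonal sum of H0 and H1.
The spectral hypothesis on A0 + V X says that B <= lambda as a quadratic form on
the graph of X, because A0 + V X is the restriction of B to this graph, read in
the coordinate x of (x, X x), and hence self-adjoint for the inner product that
the graph induces on H0 ([block_graph], [spectral_upper_bound]).

Let X and Y be two solutions, x a vector, and d = (0, w) the difference of the
graph vectors of x, with w = X x - Y x. With the functional calculus one would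
say that both graphs lie in the spectral subspace of B for (-oo, lambda], hence
so does d. The substitute for this subspace is a growth condition: the vectors z
for which the powers of C = B - lambda + c satisfy |C^n z| <= K c^n for some K
and all n form a linear subspace, which contains both graphs once c is so large
that C >= 0, and on which log-convexity of |C^n z| forces |C z| <= c |z|. On the
other hand A1 >= lambda makes the form of B - lambda nonnegative at d, and the
two facts together give (B - lambda) d = 0 ([nonneg_in_nonpos_sum]).

It remains to see that d is orthogonal to the graphs of X and Y, for then w is
orthogonal to both X x and Y x, hence to itself. The projection of d to the
graph of X again lies in the kernel of B - lambda. As A0 <= lambda <= A1, a
vector (u, v) of this kernel has u in the kernels of A0 - lambda and V^*
([block_ker]); so property (i) gives X u = 0 for the projection (u, X u), which
is therefore (u, 0). This is orthogonal to d = (0, w), hence zero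
([ker_block_orth_graph]). *)

(** * Nonnegative symmetric real forms *)

(** Forms are only linear over the reals: all estimates below concern real parts
of complex inner products, and working with real values gives a total order.
They may be degenerate, so that the quadratic forms of nonnegative operators are
among them as well as inner products. *)
Definition psd_form (R : realType) (E : lmodType R[i]) (b : E -> E -> R) :=
  [/\ forall (t : R) x y z, b (t%:C *: x + y) z = t * b x z + b y z,
      forall x y, b x y = b y x &
      forall x, 0 <= b x x].

Section PsdForm.
Variables (R : realType) (E : lmodType R[i]) (b : E -> E -> R).
Hypothesis bP : psd_form b.

Lemma psd_ge0 x : 0 <= b x x. Proof. by case: bP. Qed.

Lemma psdC x y : b x y = b y x. Proof. by case: bP. Qed.

Lemma psdDl x y z : b (x + y) z = b x z + b y z.
Proof. by case: bP => lin _ _; rewrite -[x]scale1r (lin 1) mul1r scale1r. Qed.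

Lemma psd0l z : b 0 z = 0.
Proof. by have := psdDl 0 0 z; rewrite addr0; lra. Qed.

Lemma psdZl (t : R) x z : b (t%:C *: x) z = t * b x z.
Proof. by case: bP => lin _ _; rewrite -[X in b X]addr0 lin psd0l addr0. Qed.

Lemma psdNl x z : b (- x) z = - b x z.
Proof. by have := psdDl x (- x) z; rewrite subrr psd0l; lra. Qed.

Lemma psdDr x y z : b z (x + y) = b z x + b z y.
Proof. by rewrite psdC psdDl !(psdC z). Qed.

Lemma psdZr (t : R) x z : b z (t%:C *: x) = t * b z x.
Proof. by rewrite psdC psdZl psdC. Qed.

Lemma psdNr x z : b z (- x) = - b z x.
Proof. by rewrite psdC psdNl psdC. Qed.

Definition psdE := (psdDl, psdZl, psdNl, psdDr, psdZr, psdNr).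

Lemma quadratic_ge0 (p q r : R) : 0 <= p ->
  (forall t, 0 <= r + t * q * 2 + t ^+ 2 * p) -> q ^+ 2 <= r * p.
Proof.
rewrite le_eqVlt => /predU1P[<- h|p0 h].
  have [->|q0] := eqVneq q 0; first by rewrite mulr0 expr0n.
  (* For p = 0 the expression is affine in t; at this t it equals - r - 2. *)
  have := h (- ((r + 1) / q)).
  have -> : - ((r + 1) / q) * q * 2 = - (r + 1) * 2 by field.
  have := h 0; lra.
(* The minimum of the quadratic polynomial in t. *)
have := h (- (q / p)).
have -> : r + - (q / p) * q * 2 + (- (q / p)) ^+ 2 * p = (r * p - q ^+ 2) / p.
  by field; rewrite gt_eqF.
by rewrite pmulr_lge0 ?invr_gt0// subr_ge0.
Qed.

Lemma cauchy_schwarz x y : b x y ^+ 2 <= b x x * b y y.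
Proof.
apply: quadratic_ge0 => [|t]; first exact: psd_ge0.
have := psd_ge0 (t%:C *: y + x); rewrite !psdE (psdC y x); lra.
Qed.

Lemma psd_parallelogram x y :
  b (x - y) (x - y) <= 2 * b x x + 2 * b y y.
Proof. by have := psd_ge0 (x + y); rewrite !psdE (psdC y x); lra. Qed.

(** Makes Cauchy-Schwarz available for the form of a nonnegative operator. *)
Lemma psd_op (N : E -> E) :
  (forall x y, b (N x) y = b x (N y)) -> (forall x, 0 <= b (N x) x) ->
  psd_form (fun x y => b (N x) y).
Proof.
move=> symN N0; split => // [t x y z|x y]; last by rewrite symN psdC.
by rewrite !symN psdDl psdZl.
Qed.

End PsdForm.

(** Cauchy-Schwarz for the form of N, applied to x and N x. *)
Lemma psd_ker (R : realType) (E : lmodType R[i]) (b : E -> E -> R)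
    (N : E -> E) :
  psd_form b -> (forall x y, b (N x) y = b x (N y)) ->
  (forall x, 0 <= b (N x) x) -> forall x, b (N x) x = 0 -> b (N x) (N x) = 0.
Proof.
move=> bP symN N0 x Nx; apply/eqP.
have := cauchy_schwarz (psd_op bP symN N0) x (N x).
by rewrite Nx mul0r -sqrf_eq0 eq_le sqr_ge0 andbT.
Qed.

(** * Exponential growth and the sign of a quadratic form *)

(** The ratios [a n.+1 / a n] of a log-convex sequence increase, so the first
one bounds the growth rate from below. *)
Lemma log_convex_growth (R : realType) (a : nat -> R) (K q : R) :
  0 < q -> (forall n, 0 <= a n) -> (forall n, a n.+1 ^+ 2 <= a n * a n.+2) ->
  (forall n, a n <= K * q ^+ n) -> a 1%N <= q * a 0%N.
Proof.
move=> q0 a_ge0 lc ub; apply/negP => /negP; rewrite -ltNge => lt.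
have a0 : 0 < a 0%N.
  rewrite lt_neqAle a_ge0 andbT; apply/eqP => e; have := lc 0%N.
  rewrite -e mul0r leNgt exprn_gt0//.
  by move: lt; rewrite -e mulr0.
have qa0 : 0 < q * a 0%N by rewrite mulr_gt0.
have [e e0 a1E] : exists2 e, 0 < e & a 1%N = q * (1 + e) * a 0%N.
  exists (a 1%N / (q * a 0%N) - 1); last by field; rewrite !gt_eqF.
  by rewrite subr_gt0 ltr_pdivlMr// mul1r.
have qe0 : 0 < q * (1 + e) by rewrite mulr_gt0// addr_gt0.
have ratio n : 0 < a n /\ q * (1 + e) * a n <= a n.+1.
  elim: n => [|n [an IH]]; first by rewrite -a1E.
  have an1 : 0 < a n.+1 by apply: lt_le_trans IH; rewrite mulr_gt0.
  split=> //; rewrite -(ler_pM2l an); apply: le_trans (lc n).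
  by rewrite expr2 mulrA (mulrC (a n)) ler_pM2r.
(* Bernoulli's inequality along the sequence. *)
have low n : q ^+ n * (a 0%N * (1 + n%:R * e)) <= a n.
  elim: n => [|n IH]; first by rewrite expr0 mul0r addr0 mul1r mulr1.
  apply: le_trans (ratio n).2.
  have : q * (1 + e) * (q ^+ n * (a 0%N * (1 + n%:R * e))) <=
      q * (1 + e) * a n by rewrite ler_pM2l.
  apply: le_trans; rewrite exprS -!mulrA ler_pM2l//.
  rewrite [X in _ <= X]mulrCA ler_pM2l ?exprn_gt0//.
  rewrite [X in _ <= X]mulrCA ler_pM2l// -natr1.
  have : 0 <= n%:R * (e * e) by rewrite !mulr_ge0// ltW.
  lra.
have bnd n : a 0%N * (1 + n%:R * e) <= K.
  rewrite -(ler_pM2l (exprn_gt0 n q0)) [X in _ <= X]mulrC.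
  exact: le_trans (low n) (ub n).
have ae : 0 < a 0%N * e by rewrite mulr_gt0.
have := archi_boundP (normr_ge0 (K / (a 0%N * e))).
move=> /(le_lt_trans (ler_norm _)); rewrite ltr_pdivrMr//.
have := bnd (Num.bound `|K / (a 0%N * e)|).
set m := _%:R; lra.
Qed.

Section Growth.
Variables (R : realType) (E : lmodType R[i]) (b : E -> E -> R).
Hypothesis bP : psd_form b.
Variables (B : E -> E) (c : R).
Hypothesis c0 : 0 < c.
Hypothesis symB : forall x y, b (B x) y = b x (B y).
Hypothesis addB : {morph B : x y / x - y}.
Hypothesis lowB : forall x, 0 <= b (B x) x + c * b x x.

Let C x := B x + c%:C *: x.

Let symC x y : b (C x) y = b x (C y).
Proof. by rewrite /C !(psdE bP) symB. Qed.

Let C_ge0 x : 0 <= b (C x) x.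
Proof. by rewrite /C !(psdE bP). Qed.

Let subC : {morph C : x y / x - y}.
Proof. by move=> x y; rewrite /C addB scalerBr opprD addrACA. Qed.

(** On a C-stable set where [C <= c], the form of C gives
[|C y|^4 <= (C y, y) (C (C y), C y) <= c^2 |y|^2 |C y|^2]. *)
Lemma shift_contracts (G : set E) n x :
  (forall x, G x -> G (C x)) -> (forall x, G x -> b (B x) x <= 0) -> G x ->
  b (iter n C x) (iter n C x) <= (c ^+ 2) ^+ n * b x x.
Proof.
move=> GC GB Gx; have Gn m : G (iter m C x) by elim: m => //= m /GC.
elim: n => [|n IH]; first by rewrite mul1r.
rewrite exprS -mulrA /=.
apply: (@le_trans _ _ (c ^+ 2 * b (iter n C x) (iter n C x))); last first.
  by rewrite ler_pM2l// exprn_gt0.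
move: (Gn n) (Gn n.+1); rewrite iterS; set y := iter n C x => Gy GCy.
have CG z : G z -> b (C z) z <= c * b z z.
  by move=> Gz; have := GB _ Gz; rewrite /C !(psdE bP); lra.
have CSC := cauchy_schwarz (psd_op bP symC C_ge0) y (C y).
have [p0 q0] := (CG _ Gy, CG _ GCy).
have [n1 n2] := (psd_ge0 bP y, psd_ge0 bP (C y)).
have [m1 m2] := (C_ge0 y, C_ge0 (C y)).
have [e|ne] := eqVneq (b (C y) (C y)) 0.
  by rewrite e mulr_ge0// sqr_ge0.
have pos : 0 < b (C y) (C y) by rewrite lt_neqAle eq_sym ne.
rewrite -(ler_pM2r pos) -expr2; apply: le_trans CSC _.
apply: le_trans (ler_pM m1 m2 p0 q0) _.
by rewrite le_eqVlt; apply/orP; left; apply/eqP; ring.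
Qed.

(** If B were given with its spectral projections, both stable sets would lie in
the subspace of the nonpositive part of B, and a vector there at which the form
is nonnegative is in the kernel. The subspace is replaced by a growth condition
on the iterates of [C = B + c], which is kept by differences. *)
Lemma nonneg_in_nonpos_sum (G1 G2 : set E) x y :
  (forall x, G1 x -> G1 (C x)) -> (forall x, G1 x -> b (B x) x <= 0) ->
  (forall x, G2 x -> G2 (C x)) -> (forall x, G2 x -> b (B x) x <= 0) ->
  G1 x -> G2 y -> 0 <= b (B (x - y)) (x - y) ->
  b (B (x - y)) (B (x - y)) = 0.
Proof.
move=> G1C G1B G2C G2B Gx Gy; set d := x - y => dpos.
have itB n : iter n C d = iter n C x - iter n C y.
  by elim: n => //= n ->; rewrite subC.
have ub n : b (iter n C d) (iter n C d) <=
    (2 * b x x + 2 * b y y) * (c ^+ 2) ^+ n.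
  rewrite itB; apply: le_trans (psd_parallelogram bP _ _) _.
  have := shift_contracts n G1C G1B Gx; have := shift_contracts n G2C G2B Gy.
  lra.
have := log_convex_growth (exprn_gt0 2 c0)
  (fun n => psd_ge0 bP (iter n C d)) _ ub.
rewrite /= => /(_ _)/wrap[n|].
  by rewrite {1}symC; exact: cauchy_schwarz.
(* Expanding |C d|^2 <= c^2 |d|^2 leaves |B d|^2 <= - 2 c (B d, d). *)
clearbody d => le; apply/eqP; rewrite eq_le (psd_ge0 bP) andbT.
move: le; rewrite /C !(psdE bP) (psdC bP d (B d));
  have := mulr_ge0 (ltW c0) dpos; lra.
Qed.

End Growth.

(** * The real inner product of a complex Hilbert space *)

Definition rdot (R : realType) (H : hilbertType R) (x y : H) : R :=
  complex.Re (inner x y).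

Section RealInner.
Variables (R : realType).
Implicit Types H K : hilbertType R.

Lemma sqr_norm_rdot H (x : H) : `|x| ^+ 2 = (rdot x x)%:C.
Proof. by rewrite -inner_normE RRe_real// inner_normE realX// normr_real. Qed.

Lemma rdot_psd H : psd_form (@rdot R H).
Proof.
split => [t x y z|x y|x].
- rewrite /rdot linearPl /=.
  by case: (inner x z) (inner y z) => [a b] [c d] /=; rewrite mul0r subr0.
- rewrite /rdot hermC expr0 mul1r.
  change (complex.Re (conjc (inner y x)) = complex.Re (inner y x)).
  by case: (inner y x).
- by rewrite -lecR -sqr_norm_rdot exprn_ge0.
Qed.

Lemma rdot_eq0 H (x : H) : rdot x x = 0 -> x = 0.
Proof.
move=> x0; apply/eqP; rewrite -normr_eq0 -sqrf_eq0.
by rewrite sqr_norm_rdot x0.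
Qed.

Lemma ltr_norm_rdot H (x : H) (e : R) :
  0 < e -> (`|x| < e%:C) = (rdot x x < e ^+ 2).
Proof.
move=> e0; rewrite -ltcR rmorphXn /= -sqr_norm_rdot.
rewrite ltr_pXn2r ?nnegrE ?normr_ge0//.
by rewrite lecE /= eqxx ltW.
Qed.

Lemma bounded_rdot H K (T : {linear H -> K}) : bounded_operator T ->
  exists2 M, 0 <= M & forall x, rdot (T x) (T x) <= M * rdot x x.
Proof.
move=> [M TM]; exists (M ^+ 2) => [|x]; first exact: sqr_ge0.
rewrite -lecR rmorphM /= rmorphXn /= -!sqr_norm_rdot -exprMn.
by rewrite lerXn2r ?nnegrE// (le_trans _ (TM x)).
Qed.

(** The imaginary part of [inner x z] is minus the real part of
[inner ('i *: x) z]. *)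
Lemma inner_rdot H K (T : {linear H -> K}) (y : K) (z : H) :
  (forall x, rdot (T x) y = rdot x z) -> forall x, inner (T x) y = inner x z.
Proof.
move=> h x; apply/eqP; rewrite eq_complex; apply/andP; split.
  by apply/eqP/h.
have := h ('i *: x); rewrite /rdot linearZ /= !linearZl_LR.
by rewrite ![_ * inner _ _]mulrC !ReiNIm => /oppr_inj ->.
Qed.

Lemma rdot_complete H (v : nat -> H) :
  (forall e : R, 0 < e -> exists N : nat, forall n k : nat,
     (N <= n)%N -> (N <= k)%N -> rdot (v n - v k) (v n - v k) < e) ->
  exists u, forall e : R, 0 < e -> exists N : nat, forall n : nat,
     (N <= n)%N -> rdot (u - v n) (u - v n) < e.
Proof.
move=> cv; have /cauchy_cvg/cvg_ex[u vu] : cauchy (v @ \oo).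
  apply: cauchy_exP => e e0.
  have eE : e = (complex.Re e)%:C by rewrite RRe_real// gtr0_real.
  have re0 : 0 < complex.Re e by rewrite -ltcR -eE.
  have [N hN] := cv _ (exprn_gt0 2 re0).
  exists (v N); exists N => // n /= Nn.
  by rewrite -ball_normE /= eE ltr_norm_rdot//; exact: hN.
exists u => e e0.
have s0 : 0 < Num.sqrt e by rewrite sqrtr_gt0.
move/cvgrPdist_lt: vu => /(_ (Num.sqrt e)%:C); rewrite ltcR => /(_ s0)[N _ hN].
exists N => n Nn; have := hN n Nn.
by rewrite ltr_norm_rdot// sqr_sqrtr// ltW.
Qed.

(** The representing vector minimizes [b v v - 2 f v]; completeness enters
through the parallelogram identity, which makes minimizing sequences Cauchy. The
form b may be any inner product equivalent to the one of H: below it is induced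
by the graph of an operator, and then u gives the projection to this graph. *)
Lemma riesz H (b : H -> H -> R) (C M : R) (f : H -> R) :
  psd_form b -> (forall x, rdot x x <= b x x) ->
  0 <= C -> (forall x, b x x <= C * rdot x x) ->
  (forall (t : R) x y, f (t%:C *: x + y) = t * f x + f y) ->
  0 <= M -> (forall x, f x ^+ 2 <= M * b x x) ->
  exists u, forall x, f x = b x u.
Proof.
move=> bP coer C0 bC flin M0 fM.
have fD x y : f (x + y) = f x + f y.
  by rewrite -[x]scale1r (flin 1) mul1r scale1r.
have f0 : f 0 = 0 by have := fD 0 0; rewrite addr0; lra.
have fZ t x : f (t%:C *: x) = t * f x.
  by rewrite -[X in f X]addr0 flin f0 addr0.
pose phi v := b v v - 2 * f v.
have phi_lb v : - M <= phi v.
  have b0 := psd_ge0 bP v; have := fM v; rewrite /phi => fMv.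
  suff : 2 * f v <= M + b v v by lra.
  rewrite (le_trans (ler_norm _))// -ler_sqr ?nnegrE ?addr_ge0//.
  by rewrite real_normK ?num_real//; have := sqr_ge0 (M - b v v); nra.
pose m := inf (range phi).
have hasinf : has_inf (range phi).
  split; first by exists (phi 0); exists 0.
  by exists (- M) => _ [v _ <-].
have mle v : m <= phi v by apply: ge_inf; [case: hasinf | exists v].
pose eps n : R := n.+1%:R^-1.
have eps0 n : 0 < eps n by rewrite invr_gt0.
have /choice[v vP] : forall n, exists v, phi v < m + eps n.
  by move=> n; have [_ [v _ <-] h] := inf_adherent (eps0 n) hasinf; exists v.
(* A nearly minimal vector nearly solves the Euler equation. *)
have near_min n x : (b x (v n) - f x) ^+ 2 <= eps n * b x x.
  apply: quadratic_ge0 => [|t]; first exact: psd_ge0.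
  have := mle (t%:C *: x + v n); have := vP n.
  by rewrite /phi flin !(psdE bP) (psdC bP (v n) x); lra.
(* The midpoint of v n and v k is not below the infimum. *)
have cauchy_v n k : b (v n - v k) (v n - v k) <= 2 * eps n + 2 * eps k.
  have := mle (2^-1%:C *: (v n + v k)); have := vP n; have := vP k.
  by rewrite /phi fZ fD !(psdE bP) (psdC bP (v k) (v n)); lra.
have eps_small e : 0 < e -> exists N : nat, forall n, (N <= n)%N -> eps n < e.
  move=> e0; have [N _ hN] := @near_infty_natSinv_lt R (PosNum e0).
  by exists N => n Nn; exact: hN.
have [e e0|u uP] := @rdot_complete H v.
  have [N hN] := eps_small (e / 4) ltac:(lra); exists N => n k Nn Nk.
  apply: le_lt_trans (coer _) _; apply: le_lt_trans (cauchy_v n k) _.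
  by have := hN _ Nn; have := hN _ Nk; lra.
exists u => x; apply/eqP; rewrite eq_sym -subr_eq0 -sqrf_eq0.
rewrite eq_le sqr_ge0 andbT; apply/ler_addgt0Pr => e e0; rewrite add0r.
have x0 := psd_ge0 bP x.
pose d := e / (2 * (b x x + 1)).
have d0 : 0 < d by rewrite divr_gt0//; lra.
have [N1 h1] := uP (d / (2 * (C + 1))) ltac:(by rewrite divr_gt0//; lra).
have [N2 h2] := eps_small (d / 2) ltac:(lra).
pose n := maxn N1 N2.
have dn : C * rdot (u - v n) (u - v n) <= d / 2.
  have := h1 n (leq_maxl _ _); rewrite ltr_pdivlMr; last by lra.
  by have := psd_ge0 (@rdot_psd H) (u - v n); nra.
have en : eps n < d / 2 by exact: h2 (leq_maxr _ _).
have cs := le_trans (cauchy_schwarz bP x (u - v n))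
  (ler_wpM2l x0 (le_trans (bC (u - v n)) dn)).
have split2 : (b x u - f x) ^+ 2 <=
    2 * b x (u - v n) ^+ 2 + 2 * (b x (v n) - f x) ^+ 2.
  rewrite !(psdE bP).
  by have := sqr_ge0 (b x u - b x (v n) - (b x (v n) - f x)); nra.
apply: le_trans split2 _.
have nm := near_min n x.
have : eps n * b x x <= d / 2 * b x x by rewrite ler_wpM2r// ltW.
have : d * (2 * (b x x + 1)) = e by rewrite /d; field; lra.
nra.
Qed.

(** The definition of [adjoint] has the value 0 where no adjoint vector exists;
the Riesz theorem excludes this for bounded operators. *)
Lemma rdot_adjoint H K (T : {linear H -> K}) (x : H) (y : K) :
  bounded_operator T -> rdot (T x) y = rdot x (adjoint T y).
Proof.
move=> /bounded_rdot[M M0 TM].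
have [K_psd H_psd] := (rdot_psd K, rdot_psd H).
have [|t a b|||u uP] := @riesz H (@rdot R H) 1 (M * rdot y y)
  (fun v => rdot (T v) y) H_psd (fun=> lexx _) ler01.
- by move=> a; rewrite mul1r.
- by rewrite linearP !(psdE K_psd).
- by rewrite mulr_ge0// psd_ge0.
- move=> a; apply: le_trans (cauchy_schwarz K_psd _ _) _.
  by rewrite mulrAC ler_wpM2r// psd_ge0.
suff : forall x, inner (T x) y = inner x (adjoint T y).
  by move=> h; rewrite /rdot h.
apply: (@xgetPex _ 0 [set z : H | forall x, inner (T x) y = inner x z]).
by exists u; exact: inner_rdot.
Qed.

End RealInner.

(** * From the spectrum to quadratic forms *)

Section SpectralBound.
Variables (R : realType) (H : hilbertType R) (b : H -> H -> R) (C : R).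
Hypothesis bP : psd_form b.
Hypothesis coer : forall x, rdot x x <= b x x.
Hypothesis C0 : 0 <= C.
Hypothesis bC : forall x, b x x <= C * rdot x x.

Lemma equiv_bounded (T : H -> H) (M : R) :
  0 <= M -> (forall x, rdot (T x) (T x) <= M * rdot x x) ->
  forall x, b (T x) (T x) <= C * M * b x x.
Proof.
move=> M0 TM x; rewrite (le_trans (bC _))// -mulrA ler_wpM2l//.
by rewrite (le_trans (TM x))// ler_wpM2l.
Qed.

(** Let m be the least upper bound of the form that is at least lambda. If
[m > lambda], then [N = m - T] is nonnegative with bounded inverse, and
Cauchy-Schwarz for the form of N, applied to x and its preimage under N, bounds
this form below by a positive constant; so m was not the least bound. *)
Lemma spectral_upper_bound (T : {linear H -> H}) (M lambda : R) :
  0 <= M -> (forall x, rdot (T x) (T x) <= M * rdot x x) ->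
  (forall x y, b (T x) y = b x (T y)) ->
  (forall t : R, lambda < t -> resolvent_set T t%:C) ->
  forall x, b (T x) x <= lambda * b x x.
Proof.
move=> M0 /(equiv_bounded M0) TM symT res.
pose U := [set t | lambda <= t /\ forall x, b (T x) x <= t * b x x].
pose m := inf U.
have Ulb : lbound U lambda by move=> t [].
have hasinf : has_inf U.
  split; last by exists lambda.
  exists (Num.max lambda (C * M + 1)); split; first by rewrite le_max lexx.
  move=> x; have x0 := psd_ge0 bP x.
  apply: (@le_trans _ _ ((C * M + 1) * b x x)); last first.
    by rewrite ler_wpM2r// le_max lexx orbT.
  have := psd_ge0 bP (T x - x); rewrite !(psdE bP) (psdC bP x (T x)).
  have := TM x; have := psd_ge0 bP (T x); nra.
have lm : lambda <= m by apply: lb_le_inf => //; case: hasinf.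
have mU x : b (T x) x <= m * b x x.
  apply/ler_addgt0Pr => e e0; have x0 := psd_ge0 bP x.
  have d0 : 0 < e / (b x x + 1) by rewrite divr_gt0//; lra.
  have [t [_ Tt] tm] := inf_adherent d0 hasinf.
  apply: le_trans (Tt x) _.
  have : e / (b x x + 1) * (b x x + 1) = e by field; lra.
  rewrite -/m in tm; nra.
suff : ~~ (lambda < m) by rewrite -leNgt => ml x; have -> : lambda = m
  by apply/eqP; rewrite eq_le lm.
apply/negP => lt; have [S [/bounded_rdot[MS MS0 SM] _ TS]] := res _ lt.
have {}SM := equiv_bounded MS0 SM.
pose N x := m%:C *: x - T x.
have symN x y : b (N x) y = b x (N y) by rewrite /N !(psdE bP) symT.
have N0 x : 0 <= b (N x) x by rewrite /N !(psdE bP) subr_ge0.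
have NS x : N (- S x) = x.
  by rewrite /N scalerN linearN opprK addrC TS.
pose D := C * MS.
have D0 : 0 <= D by rewrite mulr_ge0.
have low x : b x x <= (D + 1) * b (N x) x.
  have x0 := psd_ge0 bP x.
  have cs := cauchy_schwarz (psd_op bP symN N0) (- S x) x.
  rewrite NS in cs.
  have ub : b x (- S x) <= (D + 1) * b x x.
    have := psd_ge0 bP (x + S x); rewrite !(psdE bP) (psdC bP (S x) x).
    have := SM x; rewrite -/D; have := psd_ge0 bP (S x); nra.
  have [->|ne] := eqVneq (b x x) 0; first by rewrite mulr_ge0// addr_ge0.
  have pos : 0 < b x x by rewrite lt_neqAle eq_sym ne.
  rewrite -(ler_pM2l pos) -expr2; apply: le_trans cs _.
  apply: le_trans (ler_wpM2r (N0 x) ub) _.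
  by rewrite le_eqVlt; apply/orP; left; apply/eqP; ring.
have D1 : 0 < (D + 1)^-1 by rewrite invr_gt0; lra.
have /(ge_inf (proj2 hasinf)) : U (Num.max lambda (m - (D + 1)^-1)).
  split=> [|x]; first by rewrite le_max lexx.
  have x0 := psd_ge0 bP x.
  apply: (@le_trans _ _ ((m - (D + 1)^-1) * b x x)); last first.
    by rewrite ler_wpM2r// le_max lexx orbT.
  have := low x; rewrite -ler_pdivrMl; last by lra.
  by rewrite /N !(psdE bP); lra.
by rewrite -/m le_max => /orP[|]; lra.
Qed.

End SpectralBound.

Section SelfAdjointBounds.
Variables (R : realType) (H : hilbertType R) (A : {linear H -> H}) (lambda : R).
Hypothesis bA : bounded_operator A.
Hypothesis sA : self_adjoint A.

Lemma rdot_sym x y : rdot (A x) y = rdot x (A y).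
Proof. by rewrite /rdot sA. Qed.

Lemma rdot_le_sup_spectrum : (sup_spectrum A <= lambda%:E)%E ->
  forall x, rdot (A x) x <= lambda * rdot x x.
Proof.
have [M M0 AM] := bounded_rdot bA.
move=> supA; apply: (@spectral_upper_bound _ _ (@rdot R H) 1 (rdot_psd H)
  (fun=> lexx _) ler01 _ A M) => // [x||t lt].
- by rewrite mul1r.
- exact: rdot_sym.
apply: contrapT => tA.
have : (t%:E <= lambda%:E)%E.
  by apply: le_trans supA; apply: ereal_sup_ubound; exists t%:C.
by rewrite lee_fin leNgt lt.
Qed.

End SelfAdjointBounds.

Lemma rdot_ge_inf_spectrum (R : realType) (H : hilbertType R)
    (A : {linear H -> H}) (lambda : R) :
  bounded_operator A -> self_adjoint A -> (lambda%:E <= inf_spectrum A)%E ->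
  forall x, lambda * rdot x x <= rdot (A x) x.
Proof.
move=> bA sA infA x; have HP := rdot_psd H.
have [M M0 AM] := bounded_rdot bA.
suff : rdot (- A x) x <= - lambda * rdot x x by rewrite (psdE HP); lra.
apply: (@spectral_upper_bound _ _ (@rdot R H) 1 HP
  (fun=> lexx _) ler01 _ (\- A) M) => // [y|y|y z|t lt].
- by rewrite mul1r.
- by rewrite /= !(psdE HP) opprK.
- by rewrite /= !(psdE HP) rdot_sym.
have : resolvent_set A (- t)%:C.
  apply: contrapT => tA.
  have : (lambda%:E <= (- t)%:E)%E.
    by apply: le_trans infA _; apply: ereal_inf_lbound; exists (- t)%:C.
  by rewrite lee_fin; lra.
move=> [S [[K SK] SA AS]]; exists (\- S); split => [|y|y] /=.
- by exists K => y; rewrite normrN.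
- rewrite -linearN -[RHS]SA; congr (S _).
  by rewrite opprD !opprK rmorphN /= scaleNr opprK.
- rewrite linearN opprK -[RHS]AS rmorphN /= scaleNr opprK scalerN.
  by rewrite opprK.
Qed.

(** * The block operator and the graphs of the solutions *)

Section BlockOperator.
Variables (R : realType) (H0 H1 : hilbertType R).
Variables (A0 : {linear H0 -> H0}) (A1 : {linear H1 -> H1}).
Variables (V : {linear H1 -> H0}) (lambda : R).
Hypotheses (bA0 : bounded_operator A0) (sA0 : self_adjoint A0).
Hypotheses (bA1 : bounded_operator A1) (sA1 : self_adjoint A1).
Hypothesis bV : bounded_operator V.

Definition pdot (z w : H0 * H1) : R := rdot z.1 w.1 + rdot z.2 w.2.

Let P0 := rdot_psd H0.
Let P1 := rdot_psd H1.

Lemma pdot_psd : psd_form pdot.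
Proof.
rewrite /pdot; split => [t x y z|x y|x].
- by rewrite /= !(psdE P0) !(psdE P1); lra.
- by rewrite (psdC P0) (psdC P1).
- by rewrite addr_ge0// ?(psd_ge0 P0)// (psd_ge0 P1).
Qed.

Lemma pdot_eq0 z : pdot z z = 0 -> z = 0.
Proof.
have := psd_ge0 P0 z.1; have := psd_ge0 P1 z.2; rewrite /pdot => n1 n0 e.
by case: z n1 n0 e => x y /= *; congr pair; apply: rdot_eq0; lra.
Qed.

(** The block operator shifted by lambda, so that the bounds read [<= 0] and
[>= 0] and the kernel is the eigenspace of interest. *)
Definition block (z : H0 * H1) : H0 * H1 :=
  (A0 z.1 + V z.2 - lambda%:C *: z.1,
   adjoint V z.1 + A1 z.2 - lambda%:C *: z.2).

Lemma block_sym z w : pdot (block z) w = pdot z (block w).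
Proof.
rewrite /pdot /block /= !(psdE P0) !(psdE P1) (rdot_sym sA0) (rdot_sym sA1).
rewrite (rdot_adjoint _ _ bV) (psdC P1 (adjoint V z.1)) -(rdot_adjoint _ _ bV).
by rewrite (psdC P0 z.1 (V w.2)) -(rdot_adjoint _ _ bV) (psdC P0 _ z.1); lra.
Qed.

Lemma adjointB : {morph adjoint V : x y / x - y}.
Proof.
move=> x y; apply/eqP; rewrite -subr_eq0; apply/eqP/rdot_eq0.
set d := (_ - _ : H1); rewrite {2}/d !(psdE P1) -!(rdot_adjoint _ _ bV).
by rewrite !(psdE P0); lra.
Qed.

Lemma blockB : {morph block : z w / z - w}.
Proof.
have sumB (U : zmodType) (a a' b b' c c' : U) :
    a - a' + (b - b') + (- c - - c') = a + b - c - (a' + b' - c').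
  by rewrite (addrACA a) [LHS]addrACA -!opprD.
by move=> z w; rewrite /block adjointB !linearB /= !sumB.
Qed.

(** Each term of the form is bounded below by [2 (a, b) >= - |a|^2 - |b|^2]. *)
Lemma block_lower_bound :
  exists2 c, 0 < c & forall z, 0 <= pdot (block z) z + c * pdot z z.
Proof.
have [M0 M00 A0M] := bounded_rdot bA0; have [M1 M10 A1M] := bounded_rdot bA1.
have [MV MV0 VM] := bounded_rdot bV.
exists (M0 + M1 + MV + `|lambda| + 2) => [|z].
  by have := normr_ge0 lambda; lra.
rewrite /pdot /block /= !(psdE P0) !(psdE P1).
rewrite (psdC P1 (adjoint V _)) -(rdot_adjoint _ _ bV).
have := psd_ge0 P0 (A0 z.1 + z.1); have := psd_ge0 P1 (A1 z.2 + z.2).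
have := psd_ge0 P0 (V z.2 + z.1); rewrite !(psdE P0) !(psdE P1).
rewrite (psdC P0 z.1 (A0 _)) (psdC P0 z.1 (V _)) (psdC P1 z.2 (A1 _)).
have := A0M z.1; have := A1M z.2; have := VM z.2.
have x0 := psd_ge0 P0 z.1; have y0 := psd_ge0 P1 z.2.
have := mulr_ge0 M00 x0; have := mulr_ge0 M00 y0.
have := mulr_ge0 M10 x0; have := mulr_ge0 M10 y0.
have := mulr_ge0 MV0 x0; have := mulr_ge0 MV0 y0.
have la : 0 <= `|lambda| - lambda by rewrite subr_ge0 ler_norm.
have := mulr_ge0 la x0; have := mulr_ge0 la y0.
lra.
Qed.

Hypothesis A0_le : forall x, rdot (A0 x) x <= lambda * rdot x x.
Hypothesis A1_ge : forall y, lambda * rdot y y <= rdot (A1 y) y.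

(** Pairing the two rows of [block (x, y) = 0] with x and y gives
[(A0 x, x) - lambda |x|^2 = - (V y, x) = (A1 y, y) - lambda |y|^2]; the left
side is nonpositive and the right side nonnegative, so both vanish. *)
Lemma block_ker z : block z = 0 ->
  A0 z.1 - lambda%:C *: z.1 = 0 /\ adjoint V z.1 = 0.
Proof.
case: z => x y; rewrite /block /= => -[e0 e1].
have := psd0l P0 x; rewrite -e0 !(psdE P0) => f0.
have := psd0l P1 y; rewrite -e1 !(psdE P1).
rewrite (psdC P1 (adjoint V _)) -(rdot_adjoint _ _ bV) => f1.
have [ax ay] := (A0_le x, A1_ge y).
have kx : lambda%:C *: x - A0 x = 0.
  apply: rdot_eq0.
  apply: (psd_ker (N := fun x => lambda%:C *: x - A0 x) P0) => [u v|u|].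
  - by rewrite !(psdE P0) (rdot_sym sA0).
  - by have := A0_le u; rewrite !(psdE P0); lra.
  - by rewrite !(psdE P0); lra.
have ky : A1 y - lambda%:C *: y = 0.
  apply: rdot_eq0.
  apply: (psd_ker (N := fun y => A1 y - lambda%:C *: y) P1) => [u v|u|].
  - by rewrite !(psdE P1) (rdot_sym sA1).
  - by have := A1_ge u; rewrite !(psdE P1); lra.
  - by rewrite !(psdE P1); lra.
split; first by rewrite -opprB kx oppr0.
by move: e1; rewrite -addrA ky addr0.
Qed.

Section Solution.
Variable X : {linear H0 -> H1}.
Hypothesis bX : bounded_operator X.
Hypothesis ricX : riccati A0 A1 V X.
Hypothesis specX :
  spectrum (A0 \+ (V \o X)) `<=` [set t%:C | t in `]-oo, lambda]%classic].
Hypothesis kerX :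
  ker (fun x => A0 x - lambda%:C *: x) `&` ker (adjoint V) `<=` ker X.

Definition graph_pt x : H0 * H1 := (x, X x).
(** The inner product of the graph, transported to H0; it makes A0 + V X
self-adjoint. *)
Definition gdot x y := pdot (graph_pt x) (graph_pt y).
Let T : {linear H0 -> H0} := A0 \+ (V \o X).
Let shiftT x := T x - lambda%:C *: x.

Lemma gdot_psd : psd_form gdot.
Proof.
split => [t x y z|x y|x]; rewrite /gdot.
- rewrite /pdot /= linearP /= !(psdE P0) !(psdE P1); lra.
- exact: psdC pdot_psd _ _.
- exact: psd_ge0 pdot_psd _.
Qed.

Lemma rdot_le_gdot x : rdot x x <= gdot x x.
Proof. by rewrite /gdot /pdot /= lerDl (psd_ge0 P1). Qed.

Lemma gdot_bounded : exists2 C, 0 <= C & forall x, gdot x x <= C * rdot x x.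
Proof.
have [M M0 XM] := bounded_rdot bX; exists (M + 1) => [|x]; first by lra.
by rewrite /gdot /pdot /=; have := XM x; lra.
Qed.

(** The Riccati equation expresses that the graph is invariant. *)
Lemma block_graph x : block (graph_pt x) = graph_pt (shiftT x).
Proof.
rewrite /block /graph_pt /shiftT /=; congr pair.
rewrite linearB linearD [X (_ *: _)]linearZ /=; congr (_ - _).
apply/eqP; rewrite -subr_eq0; apply/eqP; rewrite -[RHS](ricX x).
by rewrite opprD -addrA addrC -!addrA.
Qed.

Lemma gdot_shift_sym x y : gdot (shiftT x) y = gdot x (shiftT y).
Proof. by rewrite /gdot -!block_graph block_sym. Qed.

Lemma block_graph_le0 x : pdot (block (graph_pt x)) (graph_pt x) <= 0.
Proof.
have [C C0 Cb] := gdot_bounded; have gP := gdot_psd.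
have [M0 M00 A0M] := bounded_rdot bA0; have [MX MX0 XM] := bounded_rdot bX.
have [MV MV0 VM] := bounded_rdot bV.
rewrite block_graph -/(gdot _ _) (psdDl gP) (psdNl gP) (psdZl gP) subr_le0.
apply: (spectral_upper_bound gP rdot_le_gdot C0 Cb
  (M := 2 * M0 + 2 * (MV * MX))) => [|{}x|{}x y|t lt].
- by rewrite addr_ge0// !mulr_ge0.
- have := psd_parallelogram P0 (A0 x) (- V (X x)); rewrite opprK.
  move=> /le_trans; apply; rewrite !(psdE P0) opprK.
  have := A0M x; have := VM (X x); have := ler_wpM2l MV0 (XM x); lra.
- have := gdot_shift_sym x y; rewrite (psdDl gP) (psdDr gP).
  rewrite !(psdNl gP, psdNr gP, psdZl gP, psdZr gP).
  lra.
- apply: contrapT => /specX[s /=]; rewrite in_itv /= => sl [st].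
  by move: lt; rewrite -st ltNge sl.
Qed.

(** The Riesz vector u is the coordinate of the projection of [(0, w)] to the
graph. As the graph is invariant and the block operator symmetric, the
projection stays in the kernel; property (i) and [block_ker] turn it into
[(u, 0)], which is orthogonal to [(0, w)] and hence zero. *)
Lemma ker_block_orth_graph (w : H1) : block (0, w) = 0 ->
  forall x, rdot w (X x) = 0.
Proof.
move=> Bw; have [C C0 Cb] := gdot_bounded; have gP := gdot_psd.
have [t x y|||u uP] := riesz (M := rdot w w) (f := fun x => rdot w (X x)) gP
    rdot_le_gdot C0 Cb.
- by rewrite linearP /= !(psdE P1).
- exact: psd_ge0 P1 _.
- move=> x; apply: le_trans (cauchy_schwarz P1 _ _) _.
  by rewrite ler_wpM2l ?(psd_ge0 P1)// /gdot /pdot /= lerDr (psd_ge0 P0).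
have gw x : gdot x u = pdot (0, w) (graph_pt x).
  by rewrite -uP /pdot /= (psd0l P0) add0r.
have Bu : block (graph_pt u) = 0.
  apply: pdot_eq0; rewrite {2}block_graph block_sym block_graph.
  rewrite (psdC pdot_psd) -/(gdot _ _) gw -block_graph -block_sym Bw.
  exact: psd0l pdot_psd _.
have [u0 u1] := block_ker Bu.
have Xu : X u = 0 by exact: kerX.
have gu x : gdot x u = rdot x u.
  by rewrite /gdot /pdot /= Xu (psdC P1) (psd0l P1) addr0.
have /rdot_eq0 u_0 : rdot u u = 0.
  by rewrite -gu -uP Xu (psdC P1) (psd0l P1).
by move=> x; rewrite uP gu u_0 (psdC P0) (psd0l P0).
Qed.

End Solution.
End BlockOperator.

(** * Uniqueness *)

Theorem theorem4p1 (R : realType) (H H0 H1 : hilbertType R)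
    (J0 : {linear H0 -> H}) (J1 : {linear H1 -> H})
    (A0 : {linear H0 -> H0}) (A1 : {linear H1 -> H1}) (V : {linear H1 -> H0})
    (lambda : R) :
  separable H ->
  orthogonal_decomposition J0 J1 ->
  bounded_operator A0 -> self_adjoint A0 ->
  bounded_operator A1 -> self_adjoint A1 ->
  bounded_operator V ->
  (sup_spectrum A0 <= lambda%:E)%E ->
  (lambda%:E <= inf_spectrum A1)%E ->
  forall X Y : {linear H0 -> H1},
  contractive_solution A0 A1 V X ->
  ker (fun x => A0 x - lambda%:C *: x) `&` ker (adjoint V) `<=` ker X ->
  spectrum (A0 \+ (V \o X)) `<=` [set t%:C | t in `]-oo, lambda]%classic] ->
  contractive_solution A0 A1 V Y ->
  ker (fun x => A0 x - lambda%:C *: x) `&` ker (adjoint V) `<=` ker Y ->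
  spectrum (A0 \+ (V \o Y)) `<=` [set t%:C | t in `]-oo, lambda]%classic] ->
  X =1 Y.
Proof.
move=> _ _ bA0 sA0 bA1 sA1 bV supA0 infA1 X Y [bX _ ricX] kerX specX
  [bY _ ricY] kerY specY x.
have A0_le := rdot_le_sup_spectrum bA0 sA0 supA0.
have A1_ge := rdot_ge_inf_spectrum bA1 sA1 infA1.
have [c c0 Blow] := block_lower_bound lambda bA0 bA1 bV.
pose B := block A0 A1 V lambda.
pose G (Z : {linear H0 -> H1}) : set (H0 * H1) := range (graph_pt Z).
have G_stable (Z : {linear H0 -> H1}) : riccati A0 A1 V Z ->
    forall z, G Z z -> G Z (B z + c%:C *: z).
  move=> ricZ _ [u _ <-]; rewrite /B block_graph// /G.
  exists ((A0 \+ (V \o Z)) u - lambda%:C *: u + c%:C *: u) => //.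
  by rewrite /graph_pt linearD [Z (c%:C *: u)]linearZ.
have G_le0 (Z : {linear H0 -> H1}) : bounded_operator Z -> riccati A0 A1 V Z ->
    spectrum (A0 \+ (V \o Z)) `<=` [set t%:C | t in `]-oo, lambda]%classic] ->
    forall z, G Z z -> pdot (B z) z <= 0.
  by move=> bZ ricZ specZ _ [u _ <-]; exact: block_graph_le0.
pose w := X x - Y x.
have dE : graph_pt X x - graph_pt Y x = (0, w).
  by rewrite -[0](subrr x).
have Bw : B (0, w) = 0.
  apply: pdot_eq0; rewrite -dE.
  apply: (nonneg_in_nonpos_sum (@pdot_psd _ _ _) c0 _ _ Blow
    (G_stable X ricX) (G_le0 X bX ricX specX)
    (G_stable Y ricY) (G_le0 Y bY ricY specY)).
  - exact: block_sym.
  - exact: blockB.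
  - by exists x.
  - by exists x.
  clearbody w; rewrite dE /pdot /=.
  rewrite (psdC (rdot_psd H0)) (psd0l (rdot_psd H0)) add0r.
  rewrite !(psdE (rdot_psd H1)).
  rewrite (psdC (rdot_psd H1) (adjoint V 0)) -?rdot_adjoint//.
  rewrite (psdC (rdot_psd H0)) (psd0l (rdot_psd H0)).
  by have := A1_ge w; lra.
have wX : rdot w (X x) = 0.
  by apply: (ker_block_orth_graph sA0 sA1 bV A0_le A1_ge bX ricX kerX Bw).
have wY : rdot w (Y x) = 0.
  by apply: (ker_block_orth_graph sA0 sA1 bV A0_le A1_ge bY ricY kerY Bw).
have /rdot_eq0/eqP : rdot w w = 0.
  by rewrite {2}/w (psdDr (rdot_psd H1)) (psdNr (rdot_psd H1)) wX wY subrr.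
by rewrite subr_eq0 => /eqP.
Qed.
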